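(* Let $0\le r<1$, $d\in\mathbb{N}$ and $n\in\mathbb{N}$ (with $d,n\ge 1$). Then $$P_1(d,r,n)>1-\frac{n}{2^{d}}.$$
   Context: $B_d=\{X\in\mathbb{R}^d:\ \|X\|\le 1\}$ is the Euclidean unit ball centered at the origin, and $rB_d$ is the ball of radius $r$ centered at the origin. $M_n=\{X_1,\ldots,X_n\}$ is a set of $n$ points chosen randomly and independently according to the uniform distribution (normalized Lebesgue measure) on the spherical layer $B_d\setminus rB_d$. A point $X\in\mathbb{R}^d$ is linearly separable from a set $M\subset\mathbb{R}^d$ if there exists $A_X\in\mathbb{R}^d$ such that $(A_X,X)>(A_X,Y)$ for all $Y\in M$, where $(\cdot,\cdot)$ is the standard inner product. $P_1(d,r,n)$ denotes the probability that a random point, chosen according to the uniform distribution on $B_d\setminus rB_d$ (independently of $M_n$), is linearly separable from $M_n$. *)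

(* Defs.v *)
From HB Require Import structures.
From mathcomp Require Import all_boot all_order all_algebra.
From mathcomp Require Import all_classical all_reals all_analysis.

Set Implicit Arguments.
Unset Strict Implicit.
Unset Printing Implicit Defensive.

Import Order.TTheory GRing.Theory Num.Theory.

Local Open Scope classical_set_scope.
Local Open Scope ring_scope.

(* R^d is the type of d-tuples over R with the library's product sigma-algebra
   (= the Borel sets of R^d).  Row vectors 'rV[R]_d are avoided because the
   library's norm on them is the sup norm. *)
Notation euclidean R d := (d.-tuple (measurableTypeR R)).

Section euclidean_geometry.
Variables (R : realType) (d : nat).
Implicit Types (X Y : euclidean R d) (M : set (euclidean R d)) (r : R).

Definition dot X Y : R := \sum_(i < d) (tnth X i : R) * (tnth Y i : R).

Definition enorm X : R := Num.sqrt (dot X X).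

(* r B_d; the unit ball B_d is [eball 1] *)
Definition eball r : set (euclidean R d) := [set X | enorm X <= r].

Definition layer r : set (euclidean R d) := eball 1 `\` eball r.

Definition linearly_separable X M : Prop :=
  exists A : euclidean R d, forall Y, M Y -> dot A X > dot A Y.

End euclidean_geometry.

(* Lebesgue measure on R^(d+1) as the image of the product of the Lebesgue
   measures on R and R^d under (x, t) |-> x :: t. *)
Section lebesgue_cons.
Variables (R : realType) (d : nat).
Local Notation RT := (measurableTypeR R).
Variable mu : {sigma_finite_measure set (euclidean R d) -> \bar R}.

Definition cons_euclidean (p : RT * euclidean R d) : euclidean R d.+1 :=
  [tuple of p.1 :: p.2].

Lemma measurable_cons_euclidean : measurable_fun [set: _] cons_euclidean.
Proof. exact: measurable_cons. Qed.

Definition lebesgue_cons : set (euclidean R d.+1) -> \bar R :=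
  pushforward (@lebesgue_measure R \x mu)%E cons_euclidean.

Let lebesgue_cons0 : lebesgue_cons set0 = 0%E.
Proof. by rewrite /lebesgue_cons /pushforward preimage_set0 measure0. Qed.

Let lebesgue_cons_ge0 A : (0 <= lebesgue_cons A)%E.
Proof. by rewrite /lebesgue_cons /pushforward measure_ge0. Qed.

Let lebesgue_cons_sigma_additive : semi_sigma_additive lebesgue_cons.
Proof.
have mpre A : measurable A -> measurable (cons_euclidean @^-1` A).
  by move=> mA; rewrite -[X in measurable X]setTI;
    exact: measurable_cons_euclidean.
move=> F mF tF mUF; rewrite /lebesgue_cons /pushforward preimage_bigcup.
apply: measure_semi_sigma_additive.
- by move=> n; exact: mpre.
- apply/trivIsetP => /= i j _ _ ij; rewrite -preimage_setI.
  by move/trivIsetP : tF => /(_ _ _ _ _ ij) ->//; rewrite preimage_set0.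
- by rewrite -preimage_bigcup; exact: mpre.
Qed.

HB.instance Definition _ := isMeasure.Build _ _ _ lebesgue_cons
  lebesgue_cons0 lebesgue_cons_ge0 lebesgue_cons_sigma_additive.

Let lebesgue_cons_sigma_finite : sigma_finite setT lebesgue_cons.
Proof.
have /sigma_finiteP[F [TF ndF Foo]] := sigma_finiteT (@lebesgue_measure R).
have /sigma_finiteP[G [TG ndG Goo]] := sigma_finiteT mu.
pose uncons (t : euclidean R d.+1) : RT * euclidean R d :=
  (thead t, [tuple of behead t]).
have consK : cancel cons_euclidean uncons.
  by case=> x t; rewrite /uncons /cons_euclidean theadE; congr (_, _);
    exact/val_inj.
have muncons : measurable_fun [set: _] uncons.
  by apply/measurable_fun_pair; [exact: measurable_tnth|
    exact: measurable_behead].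
exists (fun n => uncons @^-1` (F n `*` G n)).
  rewrite -preimage_bigcup; apply/esym/seteqP; split=> // t _ /=.
  have [i _ Fi] : (\bigcup_i F i) (uncons t).1 by rewrite -TF.
  have [j _ Gj] : (\bigcup_i G i) (uncons t).2 by rewrite -TG.
  exists (maxn i j) => //; split.
    by move: Fi; exact/subsetPset/ndF/leq_maxl.
  by move: Gj; exact/subsetPset/ndG/leq_maxr.
move=> n; have [mF Fn] := Foo n; have [mG Gn] := Goo n; split.
  by rewrite -[X in measurable X]setTI; apply: muncons => //;
    exact: measurableX.
rewrite /lebesgue_cons /pushforward -comp_preimage.
rewrite (_ : uncons \o cons_euclidean = idfun); last exact/funext.
by rewrite preimage_id product_measure1E// lte_mul_pinfty// ge0_fin_numE.
Qed.

HB.instance Definition _ := Measure_isSigmaFinite.Build _ _ _ lebesgue_cons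
  lebesgue_cons_sigma_finite.

End lebesgue_cons.

Fixpoint lebesgue_euclidean (R : realType) (d : nat) :
    {sigma_finite_measure set (euclidean R d) -> \bar R} :=
  match d return {sigma_finite_measure set (euclidean R d) -> \bar R} with
  | 0 => \d_([tuple] : euclidean R 0)
  | d'.+1 => lebesgue_cons (lebesgue_euclidean R d')
  end.

(* The value on boxes, which characterises Lebesgue measure. *)
Lemma lebesgue_euclidean_box (R : realType) (d : nat)
    (A : 'I_d -> set (measurableTypeR R)) :
  (forall i, measurable (A i)) ->
  lebesgue_euclidean R d [set X | forall i, A i (tnth X i)] =
  (\prod_(i < d) lebesgue_measure (A i))%E.
Proof.
elim: d A => [|d IHd] A mA.
  by rewrite big_ord0 /= diracE mem_set// => -[].
rewrite big_ord_recl -IHd//= /lebesgue_cons /pushforward.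
rewrite -product_measure1E//; last first.
  rewrite (_ : mkset _ = \bigcap_(i in [set: 'I_d])
      (fun X : euclidean R d => tnth X i) @^-1` A (lift ord0 i)).
    apply: fin_bigcap_measurable => // i _; rewrite -[X in measurable X]setTI.
    by apply: measurable_tnth => //; exact: mA.
  by apply/seteqP; split=> [X AX i _|X AX i]; exact: AX.
congr product_measure1; apply/seteqP; split=> -[x t] /=.
  move=> At; split=> [|i]; first exact: (At ord0).
  by have := At (lift ord0 i); rewrite tnthS.
by move=> [Ax At] i; case: (unliftP ord0 i) => [j|] ->//; rewrite tnthS.
Qed.

(* X is distributed according to the normalisation of mu on A (meaningful when
   mu A is neither 0 nor +oo, as for Lebesgue measure on a layer). *)
Definition uniformly_distributed (dO dT : measure_display)
    (Omega : measurableType dO) (T : measurableType dT) (R : realType)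
    (P : probability Omega R) (mu : {measure set T -> \bar R}) (A : set T)
    (X : {RV P >-> T}) : Prop :=
  forall B : set T, measurable B ->
    distribution P X B = (mu (A `&` B) * (fine (mu A))^-1%:E)%E.

Definition mutually_independent (dO dT : measure_display)
    (Omega : measurableType dO) (T : measurableType dT) (R : realType)
    (P : probability Omega R) (I : finType) (X : I -> {RV P >-> T}) : Prop :=
  forall (J : {set I}) (B : I -> set T), (forall i, measurable (B i)) ->
    P (\bigcap_(i in [set` J]) (X i @^-1` B i)) =
    (\prod_(i in J) P (X i @^-1` B i))%E.

(* Main.v *)
(* X is separated from Y by the functional dot X unless dot X X <= dot X Y,
   i.e. unless X lies in the ball with diameter [0, Y].  When r < |Y| <= 1, the
   part of that ball outside r B_d has volume at most that of the ball of
   radius |Y|/2 minus that of the ball with diameter [0, (r/|Y|) Y], which lies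
   in both; dividing by the volume of the layer gives the conditional failure
   probability bound 2^-d (|Y|^d - r^d) / (1 - r^d), which is at most 2^-d and
   stays away from it with positive probability.  Integrating over Y
   (independence) and a union bound over the n points conclude.  The event is
   measurable because a separating functional can be taken rational. *)
Require Import Defs.
From mathcomp Require Import all_boot all_order all_algebra.
From mathcomp Require Import all_classical all_reals all_analysis.
From mathcomp Require Import measurable_realfun.
From mathcomp Require Import ring lra.

Set Implicit Arguments.
Unset Strict Implicit.
Unset Printing Implicit Defensive.

Import Order.TTheory GRing.Theory Num.Theory.

Local Open Scope classical_set_scope.
Local Open Scope ring_scope.

(** * Lebesgue measure under homotheties composed with translations *)

(** By uniqueness of Lebesgue measure: the pushforward under the affine map, scaled by [rho], gives
    half-open intervals their length. *)
Lemma lebesgue_measure_affine (R : realType) (c rho : R) (A : set R) :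
  0 < rho -> measurable A ->
  lebesgue_measure A =
    (rho%:E * lebesgue_measure ((fun x : R => c + rho * x)%R @^-1` A))%E.
Proof.
move=> rho0 mA.
pose f : measurableTypeR R -> measurableTypeR R := fun x => c + rho * x.
have mf : measurable_fun setT f.
  by apply: measurable_funD => //; exact: mulrl_measurable.
pose nu : {measure set (measurableTypeR R) -> \bar R} :=
  mscale (NngNum (ltW rho0)) (pushforward (@lebesgue_measure R) f).
rewrite (@lebesgue_measure_unique R (nu mf)) => [||//].
  by [].
move=> _ [[a b]] _ <-.
rewrite [RHS](_ : _ = (rho%:E * lebesgue_measure (f @^-1` `]a, b]))%E)//.
rewrite (_ : f @^-1` _ = `](a - c) / rho, (b - c) / rho]%classic); last first.
  apply/seteqP; split=> x /=; rewrite !in_itv /= ltr_pdivrMr// ler_pdivlMr//;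
    by rewrite ltrBlDl lerBrDl (mulrC x).
rewrite !lebesgue_measure_itv /= !lte_fin ltr_pM2r ?invr_gt0// ltrD2r.
case: ifP => _; last by rewrite mule0.
rewrite -!EFinB -EFinM -mulrBl mulrCA divff ?gt_eqF// mulr1.
by rewrite opprB addrA subrK.
Qed.

Definition affine {R : realType} {d : nat} (c : 'I_d -> R) (rho : R)
    (X : euclidean R d) : euclidean R d :=
  [tuple c i + rho * tnth X i | i < d].

Lemma measurable_affine (R : realType) (d : nat) (c : 'I_d -> R) (rho : R) :
  measurable_fun setT (affine c rho).
Proof.
apply/measurable_fun_tnthP => i.
rewrite (_ : _ \o _ = fun X => c i + rho * tnth X i); last first.
  by apply/funext => X /=; rewrite tnth_mktuple.
apply: measurable_funD => //; apply: measurable_funM => //.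
exact: measurable_tnth.
Qed.

(** Induction on [d]: by uniqueness of the product measure it suffices to compare the two measures
    on rectangles, where the one-dimensional case and the induction hypothesis contribute [rho] and
    [rho ^+ d]. *)
Lemma lebesgue_euclidean_affine (R : realType) (d : nat) (c : 'I_d -> R)
    (rho : R) (A : set (euclidean R d)) :
  0 < rho -> measurable A ->
  lebesgue_euclidean R d A =
    ((rho ^+ d)%:E * lebesgue_euclidean R d (affine c rho @^-1` A))%E.
Proof.
move=> rho0; elim: d => [|d IHd] in c A *; move=> mA.
  rewrite expr0 mul1e (_ : _ @^-1` A = A)//.
  by apply/seteqP; split=> X /=; rewrite (tuple0 X) (tuple0 (affine _ _ _)).
(* [g] is the affine map read in the coordinates (head, tail); [consE] below states that
   [cons_euclidean] intertwines the two. *)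
pose g (p : measurableTypeR R * euclidean R d) : measurableTypeR R * euclidean R d :=
  (c ord0 + rho * p.1, affine (c \o lift ord0) rho p.2).
have mg : measurable_fun setT g.
  apply: measurable_fun_pair.
    by apply: measurable_funD => //; apply: measurable_funM.
  by apply: measurableT_comp => //; exact: measurable_affine.
have rho0' : 0 <= rho ^+ d.+1 by rewrite exprn_ge0 ?ltW.
pose nu := mscale (NngNum rho0') (pushforward
  (@lebesgue_measure R \x lebesgue_euclidean R d)%E g).
have nuE B : nu mg B = ((rho ^+ d.+1)%:E *
    (@lebesgue_measure R \x lebesgue_euclidean R d) (g @^-1` B))%E by [].
have mcons B : measurable B -> measurable (@cons_euclidean R d @^-1` B).
  by move=> mB; rewrite -[X in measurable X]setTI; exact: measurable_cons_euclidean.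
have consE : affine c rho \o @cons_euclidean R d = @cons_euclidean R d \o g.
  apply/funext => -[x t]; apply: eq_from_tnth => i.
  rewrite [LHS]tnth_mktuple; case: (unliftP ord0 i) => [j|] ->; last by [].
  by rewrite !tnthS tnth_mktuple.
have preE : @cons_euclidean R d @^-1` (affine c rho @^-1` A) =
    g @^-1` (@cons_euclidean R d @^-1` A).
  exact: (congr1 (fun f => f @^-1` A) consE).
rewrite /= /lebesgue_cons /pushforward.
rewrite (@product_measure_unique _ _ _ _ _ _ _ (nu mg)).
- by rewrite [LHS]nuE preE.
- move=> B C mB mC; rewrite [LHS]nuE (_ : g @^-1` _ = ((fun x => c ord0 + rho * x) @^-1` B) `*`
     (affine (c \o lift ord0) rho @^-1` C)); last by [].
  rewrite product_measure1E; last 2 first.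
  + rewrite -[X in measurable X]setTI.
    suff: measurable_fun setT (fun x : measurableTypeR R => c ord0 + rho * x : measurableTypeR R) by exact.
    by apply: measurable_funD => //; exact: mulrl_measurable.
  + by rewrite -[X in measurable X]setTI; exact: measurable_affine.
  rewrite [RHS](_ : _ = lebesgue_measure B * lebesgue_euclidean R d C)%E//.
  rewrite (lebesgue_measure_affine (c ord0) rho0 mB)// (IHd (c \o lift ord0) _ mC)//.
  by rewrite exprS EFinM muleACA.
- exact: mcons.
Qed.

(** * Measurability of sets defined by inner products *)

Lemma measurable_dot (R : realType) (d : nat) (dT : measure_display)
    (T : measurableType dT) (f g : T -> euclidean R d) :
  measurable_fun setT f -> measurable_fun setT g ->
  measurable_fun setT (fun x => dot (f x) (g x) : R).
Proof.
move=> mf mg; apply: measurable_sum => i; apply: measurable_funM.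
  exact: (measurableT_comp (measurable_tnth i) mf).
exact: (measurableT_comp (measurable_tnth i) mg).
Qed.

Lemma measurable_sublevel (R : realType) (dT : measure_display)
    (T : measurableType dT) (f g : T -> R) :
  measurable_fun setT f -> measurable_fun setT g ->
  measurable [set x | f x <= g x].
Proof.
move=> mf mg.
rewrite (_ : mkset _ = setT `&` (fun x => f x <= g x) @^-1` [set true]).
  exact: measurable_fun_ler.
by rewrite setTI.
Qed.

Lemma measurable_strict_sublevel (R : realType) (dT : measure_display)
    (T : measurableType dT) (f g : T -> R) :
  measurable_fun setT f -> measurable_fun setT g ->
  measurable [set x | f x < g x].
Proof.
move=> mf mg; rewrite (_ : mkset _ = ~` [set x | g x <= f x]).
  by apply: measurableC; exact: measurable_sublevel.
by apply/seteqP; split=> x /=; [rewrite ltNge => /negP|move/negP; rewrite -ltNge].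
Qed.

Lemma dot_ge0 (R : realType) (d : nat) (X : euclidean R d) : 0 <= dot X X.
Proof. by apply: sumr_ge0 => i _; rewrite -expr2 sqr_ge0. Qed.

(** * Balls with arbitrary centre and their volumes *)

(** The squared form avoids square roots and makes the set polynomial in the coordinates; it is the
    usual ball when [rho] is nonnegative. *)
Definition cball {R : realType} {d : nat} (c : 'I_d -> R) (rho : R) :
    set (euclidean R d) :=
  [set X | \sum_(i < d) ((tnth X i : R) - c i) ^+ 2 <= rho ^+ 2].

Lemma sum_sqr_sub (R : realType) (d : nat) (a : R) (X Y : euclidean R d) :
  \sum_(i < d) ((tnth X i : R) - a * tnth Y i) ^+ 2 =
  dot X X - 2 * a * dot X Y + a ^+ 2 * dot Y Y.
Proof.
rewrite /dot !mulr_sumr -sumrB -big_split /=; apply: eq_bigr => i _; ring.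
Qed.

Lemma eball_dot (R : realType) (d : nat) (rho : R) (X : euclidean R d) :
  0 <= rho -> eball rho X <-> dot X X <= rho ^+ 2.
Proof.
move=> rho0; rewrite /eball /= /enorm.
by rewrite -{1}(ger0_norm rho0) -sqrtr_sqr ler_sqrt ?sqr_ge0.
Qed.

Lemma eball_cball (R : realType) (d : nat) (rho : R) : 0 <= rho ->
  @eball R d rho = cball (fun=> 0) rho.
Proof.
move=> rho0; apply/seteqP; split=> X; rewrite eball_dot// /cball /= /dot.
  by under [X in _ -> X <= _]eq_bigr do rewrite subr0 expr2.
by under [X in X <= _ -> _]eq_bigr do rewrite subr0 expr2.
Qed.

(* Thales: the ball on the left has the segment from 0 to k Y as a diameter. *)
Lemma cball_diameter (R : realType) (d : nat) (k : R) (X Y : euclidean R d) :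
  cball (fun i => k / 2 * (tnth Y i : R)) (k * enorm Y / 2) X <->
  dot X X <= k * dot X Y.
Proof.
rewrite /cball /= sum_sqr_sub.
have -> : (k * enorm Y / 2) ^+ 2 = (k / 2) ^+ 2 * dot Y Y.
  by rewrite -(sqr_sqrtr (dot_ge0 Y)); rewrite /enorm; field.
by rewrite gerDr subr_le0 (_ : 2 * (k / 2) = k)//; field.
Qed.

Lemma measurable_cball (R : realType) (d : nat) (c : 'I_d -> R) (rho : R) :
  measurable (cball c rho).
Proof.
apply: measurable_sublevel => //; apply: measurable_sum => i.
apply: measurable_funX; apply: measurable_funB => //.
exact: measurable_tnth.
Qed.

Lemma measurable_eball (R : realType) (d : nat) (rho : R) :
  measurable (@eball R d rho).
Proof.
have [rho0|rho0] := leP 0 rho; first by rewrite eball_cball//; exact: measurable_cball.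
rewrite (_ : eball rho = set0)//; apply/seteqP; split=> // X.
by rewrite /eball /= leNgt (lt_le_trans rho0)// sqrtr_ge0.
Qed.

Lemma cball_sub_box (R : realType) (d : nat) (c : 'I_d -> R) (rho : R) :
  0 <= rho ->
  cball c rho `<=` [set X | forall i, `[c i - rho, c i + rho]%classic (tnth X i)].
Proof.
move=> rho0 X /= BX i; rewrite in_itv /= -ler_distl.
rewrite -ler_sqr ?nnegrE// real_normK ?num_real//.
by apply: le_trans BX; rewrite (bigD1 i)//= lerDl sumr_ge0// => j _; rewrite sqr_ge0.
Qed.

(** A crude bound by the circumscribed cube, which serves to show that balls have finite volume and
    that balls of radius 0 are null. *)
Lemma lebesgue_cball_box (R : realType) (d : nat) (c : 'I_d -> R) (rho : R) :
  0 <= rho ->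
  (lebesgue_euclidean R d (cball c rho) <= ((2 * rho) ^+ d)%:E)%E.
Proof.
move=> rho0.
apply: (@le_trans _ _ (lebesgue_euclidean R d
    [set X | forall i, `[c i - rho, c i + rho]%classic (tnth X i)])).
  apply: le_measure; rewrite ?inE.
  - exact: measurable_cball.
  - rewrite (_ : mkset _ = \bigcap_(i in [set: 'I_d])
      (fun X : euclidean R d => tnth X i) @^-1` `[c i - rho, c i + rho]%classic).
      apply: fin_bigcap_measurable => // i _; rewrite -[X in measurable X]setTI.
      by apply: measurable_tnth => //; exact: measurable_itv.
    by apply/seteqP; split=> [X AX i _|X AX i]; exact: AX.
  - exact: cball_sub_box.
rewrite (@lebesgue_euclidean_box R d (fun i => `[c i - rho, c i + rho]%classic)); last first.
  by move=> i; exact: measurable_itv.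
rewrite (eq_bigr (fun=> (2 * rho)%:E)); last first.
  move=> i _; rewrite lebesgue_measure_itv /= lte_fin.
  have -> : (c i + rho)%:E = (2 * rho + (c i - rho))%:E by congr (_%:E); ring.
  rewrite -EFinD addrK; case: ltP => // h.
  by congr (_%:E); lra.
by rewrite prodEFin prodr_const card_ord.
Qed.

(** The ball is an affine image of the unit ball. Radius 0 is treated apart, since the scaling lemma
    wants a positive factor; there [0 < d] makes [rho ^+ d] vanish. *)
Lemma lebesgue_cball (R : realType) (d : nat) (c : 'I_d -> R) (rho : R) :
  (0 < d)%N -> 0 <= rho ->
  lebesgue_euclidean R d (cball c rho) =
    (rho ^+ d * fine (lebesgue_euclidean R d (eball 1)))%:E.
Proof.
move=> d0; rewrite le0r => /orP[/eqP->|rho0].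
  rewrite expr0n gtn_eqF// mul0r; apply/eqP; rewrite eq_le measure_ge0 andbT.
  by rewrite (le_trans (@lebesgue_cball_box _ _ _ _ _))// mulr0 expr0n gtn_eqF.
rewrite EFinM fineK; last first.
  rewrite ge0_fin_numE// eball_cball//.
  by rewrite (le_lt_trans (@lebesgue_cball_box _ _ _ _ _))// ltry.
rewrite (@lebesgue_euclidean_affine _ _ c rho)//; last exact: measurable_cball.
rewrite eball_cball// (_ : affine _ _ @^-1` _ = cball (fun=> 0) 1)//.
have E X : \sum_(i < d) ((tnth (affine c rho X) i : R) - c i) ^+ 2 =
    rho ^+ 2 * \sum_(i < d) ((tnth X i : R) - 0) ^+ 2.
  by rewrite mulr_sumr; apply: eq_bigr => i _; rewrite tnth_mktuple; ring.
have rho2 : 0 < rho ^+ 2 by rewrite exprn_gt0.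
by apply/seteqP; split=> X; rewrite /cball /= E expr1n -{2}(mulr1 (rho ^+ 2)) ler_pM2l.
Qed.

Lemma lebesgue_cballD (R : realType) (d : nat) (c c' : 'I_d -> R)
    (rho rho' : R) :
  (0 < d)%N -> 0 <= rho -> 0 <= rho' -> cball c' rho' `<=` cball c rho ->
  lebesgue_euclidean R d (cball c rho `\` cball c' rho') =
    ((rho ^+ d - rho' ^+ d) * fine (lebesgue_euclidean R d (eball 1)))%:E.
Proof.
move=> d0 rho0 rho0' sub; transitivity (lebesgue_euclidean R d (cball c rho) -
    lebesgue_euclidean R d (cball c' rho'))%E; last first.
  by rewrite !lebesgue_cball// mulrBl EFinB.
rewrite -[in RHS](setIidr sub) -measureD//.
- exact: measurable_cball.
- exact: measurable_cball.
- by rewrite [ltLHS]lebesgue_cball// ltry.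
Qed.

Lemma lebesgue_layerI_eball (R : realType) (d : nat) (r t : R) :
  (0 < d)%N -> 0 <= r -> r <= t -> t <= 1 ->
  lebesgue_euclidean R d (layer r `&` eball t) =
    ((t ^+ d - r ^+ d) * fine (lebesgue_euclidean R d (eball 1)))%:E.
Proof.
move=> d0 r0 rt t1; have t0 := le_trans r0 rt.
rewrite (_ : layer r `&` eball t = eball t `\` eball r).
  rewrite !eball_cball// lebesgue_cballD// -!eball_cball//.
  by move=> X /= /le_trans; exact.
apply/seteqP; split=> X; rewrite /layer /eball /=; first by case=> -[].
by case=> Xt Xr; split=> //; split=> //; exact: le_trans Xt t1.
Qed.

Lemma layerT (R : realType) (d : nat) (r : R) :
  @layer R d r = layer r `&` eball 1.
Proof. by apply/seteqP; split=> X; [case=> ? ?; split|case]. Qed.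

Lemma lebesgue_layer (R : realType) (d : nat) (r : R) :
  (0 < d)%N -> 0 <= r -> r <= 1 ->
  lebesgue_euclidean R d (layer r) =
    ((1 - r ^+ d) * fine (lebesgue_euclidean R d (eball 1)))%:E.
Proof. by move=> d0 r0 r1; rewrite layerT lebesgue_layerI_eball// expr1n. Qed.

(** * Volume of the part of the layer not separated from a given point *)

Lemma dot_eq0 (R : realType) (d : nat) (X Y : euclidean R d) :
  dot X X <= 0 -> dot X Y = 0.
Proof.
move=> X0; have {}X0 : dot X X = 0 by apply/eqP; rewrite eq_le X0 dot_ge0.
apply: big1 => i _; suff Xi0 : (tnth X i : R) = 0 :> R by rewrite Xi0 mul0r.
apply/eqP; rewrite -sqrf_eq0 expr2; apply/eqP.
by apply: (psumr_eq0P _ X0) => // j _; rewrite -expr2 sqr_ge0.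
Qed.

(* The points X of the layer not separated from Y by the functional dot X form
   the part outside [eball r] of the ball with diameter [0, Y], and the ball
   with diameter [0, (r / |Y|) Y] lies in both balls. *)
Lemma lebesgue_layer_nonsep (R : realType) (d : nat) (r : R)
    (Y : euclidean R d) :
  (0 < d)%N -> 0 <= r -> r < enorm Y ->
  (lebesgue_euclidean R d (layer r `&` [set X | dot X X <= dot X Y]%R) <=
   ((enorm Y ^+ d - r ^+ d) / 2 ^+ d *
      fine (lebesgue_euclidean R d (eball 1)))%:E)%E.
Proof.
move=> d0 r0 rY; set s := enorm Y in rY *.
have s0 : 0 < s by exact: le_lt_trans rY.
have s2 : s ^+ 2 = dot Y Y by rewrite sqr_sqrtr// dot_ge0.
pose k := r / s.
have ks : k * s = r by rewrite mulfVK// gt_eqF.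
have k0 : 0 <= k by rewrite divr_ge0// ltW.
have k1 : k <= 1 by rewrite ler_pdivrMr// mul1r ltW.
pose A := cball (fun i => 1 / 2 * (tnth Y i : R)) (1 * s / 2).
pose B := cball (fun i => k / 2 * (tnth Y i : R)) (k * s / 2).
have AE X : A X <-> dot X X <= dot X Y.
  by rewrite -[in X in _ <-> X](mul1r (dot X Y)); exact: cball_diameter.
have BE X : B X <-> dot X X <= k * dot X Y by exact: cball_diameter.
have BA : B `<=` A.
  move=> X /BE XB; apply/AE.
  (* If [dot X Y] is nonnegative, [k <= 1] suffices; otherwise membership in [B] forces [X] to be
     0. *)
  have [XY0|XY0] := leP 0 (dot X Y).
    by rewrite (le_trans XB)// ler_piMl.
  by rewrite (dot_eq0 Y) ?(le_trans XB)// mulr_ge0_le0// ltW.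
have Br X : B X -> eball r X.
  move=> /BE XB; apply/eball_dot => //.
  (* Expanding this square gives [2 * k * dot X Y <= dot X X + r ^+ 2], while membership in [B]
     bounds [2 * dot X X] by the left side. *)
  have : 0 <= \sum_(i < d) ((tnth X i : R) - k * tnth Y i) ^+ 2.
    by apply: sumr_ge0 => i _; rewrite sqr_ge0.
  by rewrite sum_sqr_sub -s2 -exprMn ks; lra.
have -> : (s ^+ d - r ^+ d) / 2 ^+ d = (1 * s / 2) ^+ d - (k * s / 2) ^+ d.
  by rewrite mul1r ks !expr_div_n mulrBl.
rewrite -(@lebesgue_cballD _ _ (fun i => 1 / 2 * (tnth Y i : R))
  (fun i => k / 2 * (tnth Y i : R)))//; last 2 first.
- by rewrite mul1r divr_ge0// ltW.
- by rewrite ks divr_ge0.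
apply: le_measure; rewrite ?inE.
- apply: measurableI; first by apply: measurableD; exact: measurable_eball.
  by apply: measurable_sublevel; apply: measurable_dot => //; exact: measurable_cst.
- by apply: measurableD; exact: measurable_cball.
- by move=> X [[_ Xr] XY]; split; [exact/AE|move=> /Br].
Qed.

(** * The uniform distribution on the layer *)

Section uniform_layer.
Context {R : realType} {d : nat} {r : R} {dO : measure_display}.
Context {Omega : measurableType dO} {P : probability Omega R}.
Variable X : {RV P >-> euclidean R d}.
Hypotheses (d0 : (0 < d)%N) (r0 : 0 <= r) (r1 : r < 1).
Hypothesis uX : uniformly_distributed (lebesgue_euclidean R d) (layer r) X.

Local Notation V := (fine (lebesgue_euclidean R d (eball 1))).

Lemma uniform_layerE (B : set (euclidean R d)) : measurable B ->
  distribution P X B =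
    (lebesgue_euclidean R d (layer r `&` B) * (((1 - r ^+ d) * V)^-1)%:E)%E.
Proof.
move=> mB; rewrite uX//; congr (_ * (_^-1)%:E)%E.
by have /(congr1 fine) := lebesgue_layer d0 r0 (ltW r1).
Qed.

Lemma layer_gap_gt0 : 0 < 1 - r ^+ d.
Proof. by rewrite subr_gt0 exprn_ilt1// gtn_eqF. Qed.

(** Positivity follows from the existence of [X]: with [V = 0] its distribution would have total
    mass 0 instead of 1. *)
Lemma volume_gt0 : 0 < V.
Proof.
rewrite lt0r fine_ge0// andbT; apply/eqP => V0.
have := uniform_layerE measurableT; rewrite setIT (lebesgue_layer d0 r0 (ltW r1)) V0 mulr0 mul0e.
by rewrite probability_setT => /eqP; rewrite onee_eq0.
Qed.

Lemma uniform_layer_eball (t : R) : r <= t -> t <= 1 ->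
  distribution P X (eball t) = ((t ^+ d - r ^+ d) / (1 - r ^+ d))%:E.
Proof.
move=> rt t1; rewrite uniform_layerE; last exact: measurable_eball.
rewrite lebesgue_layerI_eball//= -EFinM.
have := layer_gap_gt0; have := volume_gt0; set D := 1 - _ => V0 D0.
by congr (_%:E); field; rewrite !gt_eqF.
Qed.

Lemma uniform_layerC : distribution P X (~` layer r) = 0%E.
Proof.
rewrite uniform_layerE; last first.
  by apply: measurableC; apply: measurableD; exact: measurable_eball.
by rewrite setICr measure0 mul0e.
Qed.

Lemma uniform_layer_nonsep (Y : euclidean R d) : r < enorm Y ->
  (distribution P X [set x | dot x x <= dot x Y]%R <=
    (2 ^- d * ((enorm Y ^+ d - r ^+ d) / (1 - r ^+ d)))%:E)%E.
Proof.
move=> rY; rewrite uniform_layerE; last first.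
  by apply: measurable_sublevel; apply: measurable_dot => //; exact: measurable_cst.
have D0 := layer_gap_gt0; have V0 := volume_gt0.
have V0' : (0 <= (((1 - r ^+ d) * V)^-1)%:E :> \bar R)%E.
  by rewrite lee_fin invr_ge0 ltW// mulr_gt0.
apply: (le_trans (lee_wpmul2r V0' (lebesgue_layer_nonsep d0 r0 rY))).
rewrite -EFinM lee_fin le_eqVlt; apply/orP; left; apply/eqP.
by field; rewrite !gt_eqF//= exprn_gt0.
Qed.

End uniform_layer.

(** * The strict bound for a single pair of points *)

(** Splitting the integral along [S] leaves a gap of at least [(C - c) * m S] below [C]; the
    pointwise bounds are asked only on [D], whose complement is null. *)
Lemma integral_lt_cst (R : realType) (dT : measure_display)
    (T : measurableType dT) (m : probability T R) (f : T -> \bar R)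
    (D S : set T) (c C : R) :
  measurable_fun setT f -> (forall x, 0 <= f x)%E ->
  measurable D -> m (~` D) = 0%E -> measurable S -> (0 < m S)%E ->
  0 <= c -> c < C ->
  (forall x, D x -> f x <= C%:E)%E -> (forall x, D x -> S x -> f x <= c%:E)%E ->
  (\int[m]_x f x < C%:E)%E.
Proof.
move=> mf f0 mD mDC mS mS0 c0 cC fC fc.
have mSC : measurable (~` S) by exact: measurableC.
have leae (A : set T) (k : R) : measurable A -> 0 <= k ->
    (forall x, D x -> A x -> f x <= k%:E)%E ->
    (\int[m]_(x in A) f x <= k%:E * m A)%E.
  move=> mA k0 fk; rewrite -integral_cst//; apply: ae_ge0_le_integral => //.
  - exact: measurable_funTS.
  - exists (~` D); split=> //; first exact: measurableC.
    by move=> x /= nfk Dx; apply: nfk => Ax; exact: fk.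
rewrite -(setvU S) ge0_integral_setU//; last 2 first.
- by rewrite setvU.
- by rewrite disj_set_sym; apply/disj_setPS; rewrite setICr.
apply: (le_lt_trans (leeD (leae _ C _ _ _) (leae _ c _ _ _))) => //.
- by rewrite ltW// (le_lt_trans c0).
- by move=> x Dx _; exact: fC.
rewrite probability_setC//.
have mSfin : m S \is a fin_num by exact: fin_num_measure.
move: mS0; rewrite -(fineK mSfin) lte_fin => p0.
rewrite -EFinB -!EFinM -EFinD lte_fin.
rewrite -subr_gt0 (_ : _ - _ = (C - c) * fine (m S)); last by ring.
by rewrite mulr_gt0// subr_gt0.
Qed.

Section pair_nonsep.
Context {R : realType} {d : nat} {r : R} {dO : measure_display}.
Context {Omega : measurableType dO} {P : probability Omega R}.
Variables X Y : {RV P >-> euclidean R d}.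
Hypotheses (d0 : (0 < d)%N) (r0 : 0 <= r) (r1 : r < 1).
Hypothesis uX : uniformly_distributed (lebesgue_euclidean R d) (layer r) X.
Hypothesis uY : uniformly_distributed (lebesgue_euclidean R d) (layer r) Y.
Hypothesis indep : forall A B, measurable A -> measurable B ->
  P (Y @^-1` A `&` X @^-1` B) = (P (Y @^-1` A) * P (X @^-1` B))%E.

Lemma probability_nonsep_lt :
  (P [set w | dot (X w) (X w) <= dot (X w) (Y w)]%R < (2 ^- d)%:E)%E.
Proof.
pose N : set (euclidean R d * euclidean R d) :=
  [set p | dot p.2 p.2 <= dot p.2 p.1].
have mN : measurable N.
  by apply: measurable_sublevel; apply: measurable_dot => //;
    exact: measurable_fst.
pose Z w := (Y w, X w).
have mZ : measurable_fun setT Z by exact: measurable_fun_pair.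
rewrite [ltLHS](_ : _ = pushforward P Z N)//.
(* By independence the joint law of [(Y, X)] is the product of the marginals. With [Y] as first
   factor, its value on [N] is the integral over [y] of the law of [X] on the section at [y]. *)
rewrite -(@product_measure_unique _ _ _ _ R
  (distribution P Y) (distribution P X) (pushforward P Z))//.
pose p : R -> R := fun t => (t ^+ d - r ^+ d) / (1 - r ^+ d).
have D0 := layer_gap_gt0 d0 r0 r1.
have p_le s t : 0 <= s -> s <= t -> p s <= p t.
  move=> s0 st; rewrite ler_pM2r ?invr_gt0// lerB// lerXn2r ?nnegrE//.
  exact: le_trans st.
have p1 : p 1 = 1 by rewrite /p expr1n divff// gt_eqF.
(* Any radius strictly between [r] and 1 would do: [eball t] then has positive mass [p t], and on it
   the section bound drops to [2 ^- d * p t]. *)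
pose t := (1 + r) / 2.
have rt : r < t by move: r0 r1; rewrite /t => *; lra.
have t1 : t < 1 by move: r0 r1; rewrite /t => *; lra.
have pt_lt1 : p t < 1.
  rewrite -p1 ltr_pM2r ?invr_gt0// ltrD2r ltrXn2r ?gtn_eqF//.
  exact: le_trans (ltW rt).
have pt_gt0 : 0 < p t.
  rewrite divr_gt0// subr_gt0 ltrXn2r ?gtn_eqF//.
have i2 : 0 < 2 ^- d :> R by rewrite invr_gt0 exprn_gt0.
have secE y : xsection N y = [set x | dot x x <= dot x y].
  by apply/seteqP; split=> x; rewrite /xsection /= inE.
apply: (@integral_lt_cst _ _ _ _ _ (layer r) (eball t) (2 ^- d * p t)).
- exact: measurable_fun_xsection.
- by move=> y; exact: measure_ge0.
- by apply: measurableD; exact: measurable_eball.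
- exact: (uniform_layerC d0 r0 r1 uY).
- exact: measurable_eball.
- by rewrite [ltRHS](uniform_layer_eball d0 r0 r1 uY (ltW rt) (ltW t1)) lte_fin.
- by rewrite mulr_ge0 ?ltW.
- by rewrite gtr_pMr.
- move=> y [y1 /negP]; rewrite -ltNge => yr.
  rewrite /= secE (le_trans (uniform_layer_nonsep d0 r0 r1 uX yr))//.
  rewrite lee_fin ler_piMr ?(ltW i2)// -[leRHS]p1.
  by apply: p_le => //; exact: sqrtr_ge0.
- move=> y [y1 /negP]; rewrite -ltNge => yr yt.
  rewrite /= secE (le_trans (uniform_layer_nonsep d0 r0 r1 uX yr))//.
  rewrite lee_fin ler_pM2l//.
  by apply: p_le => //; exact: sqrtr_ge0.
Qed.

End pair_nonsep.

(** * Pairwise independence and measurability of the separability event *)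

Lemma mutually_independent_pair (dO dT : measure_display)
    (Omega : measurableType dO) (T : measurableType dT) (R : realType)
    (P : probability Omega R) (I : finType) (X : I -> {RV P >-> T}) (i j : I)
    (A B : set T) :
  mutually_independent X -> i != j -> measurable A -> measurable B ->
  P (X i @^-1` A `&` X j @^-1` B) = (P (X i @^-1` A) * P (X j @^-1` B))%E.
Proof.
move=> indX ij mA mB.
have := indX [set i; j]%SET (fun k => if k == i then A else B).
rewrite big_setU1 ?inE//= big_set1 eqxx eq_sym (negbTE ij) => <-; last first.
  by move=> k; case: ifP.
congr (P _); apply/seteqP; split=> [w [iA jB] k /=|w wX].
  by rewrite !inE => /orP[]/eqP->; rewrite ?eqxx// eq_sym (negbTE ij).
have := wX i; have := wX j; rewrite /= !inE !eqxx orbT eq_sym (negbTE ij).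
by move=> /(_ isT) jB /(_ isT) iA; split.
Qed.

Lemma dot_sub_le (R : realType) (d : nat) (A B Z : euclidean R d) (e : R) :
  (forall i, `|(tnth A i : R) - tnth B i| <= e) ->
  `|dot A Z - dot B Z| <= e * \sum_(i < d) `|tnth Z i : R|.
Proof.
move=> AB; rewrite /dot -sumrB mulr_sumr.
apply: (le_trans (ler_norm_sum _ _ _)); apply: ler_sum => i _.
by rewrite -mulrBl normrM ler_wpM2r.
Qed.

(** Finitely many strict inequalities survive a small perturbation of the functional, so the event
    is a countable union, over rational functionals, of finite intersections. *)
Lemma measurable_linearly_separable (R : realType) (d n : nat)
    (dO : measure_display) (Omega : measurableType dO)
    (X : Omega -> euclidean R d) (Xs : 'I_n -> Omega -> euclidean R d) :
  measurable_fun setT X -> (forall i, measurable_fun setT (Xs i)) ->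
  measurable [set w | linearly_separable (X w) [set Xs i w | i in [set: 'I_n]]].
Proof.
move=> mX mXs.
pose q (a : d.-tuple rat) : euclidean R d := [tuple ratr (tnth a i) | i < d].
rewrite (_ : mkset _ = \bigcup_(a : d.-tuple rat) \bigcap_(i in [set: 'I_n])
    [set w | dot (q a) (Xs i w) < dot (q a) (X w)]); last first.
  apply/seteqP; split=> w /=; last first.
    by move=> [a _ qa]; exists (q a) => _ [i _ <-]; exact: qa.
  move=> [A sepA].
  pose m i := dot A (X w) - dot A (Xs i w).
  have m0 i : 0 < m i by rewrite subr_gt0; apply: sepA; exists i.
  (* Moving each coordinate of [A] by at most [e] shrinks the margin [m i] by at most [e * K i]. *)
  pose K i := \sum_(j < d) `|tnth (X w) j : R| + \sum_(j < d) `|tnth (Xs i w) j : R|.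
  have K0 i : 0 <= K i by rewrite addr_ge0 ?sumr_ge0.
  (* The inverse of [e] exceeds every [K i / m i], so one [e] serves all indices; the added 1 keeps
     it positive even if the sum is 0. *)
  pose e := (1 + \sum_i K i / m i)^-1.
  have e0 : 0 < e.
    by rewrite invr_gt0 ltr_wpDr// sumr_ge0// => i _; rewrite divr_ge0// ltW.
  have eK i : e * K i < m i.
    rewrite /e mulrC ltr_pdivrMr; last by rewrite -invr_gt0.
    rewrite mulrC -ltr_pdivrMr//.
    rewrite (bigD1 i)//= ltr_pwDl// lerDl sumr_ge0// => j _.
    by rewrite divr_ge0// ltW.
  have [a qa] : exists a : d.-tuple rat,
      forall i, `|(tnth (q a) i : R) - tnth A i| <= e.
    have ex i : exists x : rat, `|ratr x - (tnth A i : R)| <= e.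
      have [x] := @rat_in_itvoo R (tnth A i) ((tnth A i : R) + e) ltac:(by rewrite ltrDl).
      rewrite in_itv /= => /andP[x1 x2]; exists x.
      by rewrite ger0_norm ?subr_ge0 ?ltW// ltrBlDl.
    exists [tuple projT1 (cid (ex i)) | i < d] => i.
    by rewrite !tnth_mktuple; exact: (projT2 (cid (ex i))).
  exists a => // i _ /=.
  have := dot_sub_le (X w) qa; have := dot_sub_le (Xs i w) qa.
  have := eK i; rewrite /K /m mulrDr !ler_norml => h1 /andP[_ h2] /andP[h3 _].
  by lra.
apply: countable_bigcupT_measurable => [|a]; first exact: countableP.
apply: fin_bigcap_measurable => // i _.
by apply: measurable_strict_sublevel; apply: measurable_dot => //;
  exact: measurable_cst.
Qed.

(** * The union bound over the sample *)

Unset Implicit Arguments.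

Theorem theorem1 (R : realType) (d n : nat) (r : R)
    (dO : measure_display) (Omega : measurableType dO)
    (P : probability Omega R)
    (X : {RV P >-> euclidean R d}) (Xs : 'I_n -> {RV P >-> euclidean R d}) :
  (0 < d)%N -> (0 < n)%N -> 0 <= r < 1 ->
  uniformly_distributed (lebesgue_euclidean R d) (layer r) X ->
  (forall i, uniformly_distributed (lebesgue_euclidean R d) (layer r) (Xs i)) ->
  mutually_independent (oapp Xs X) ->
  ((1 - n%:R / 2 ^+ d)%:E <
     P [set w | linearly_separable (X w) [set Xs i w | i in [set: 'I_n]]])%E.
Proof.
move=> d0 n0 /andP[r0 r1] uX uXs indX.
set S := [set w | _].
have mS : measurable S by exact: measurable_linearly_separable.
pose N i : set Omega := [set w | dot (X w) (X w) <= dot (X w) (Xs i w)].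
have mN i : measurable (N i).
  by apply: measurable_sublevel; apply: measurable_dot.
have PN i : fine (P (N i)) < 2 ^- d.
  rewrite -lte_fin fineK; last exact: fin_num_measure.
  apply: (probability_nonsep_lt d0 r0 r1 uX (uXs i)) => A B mA mB.
  (* In the family [oapp Xs X], the index [None] stands for [X] and [Some i] for [Xs i]. *)
  exact: (mutually_independent_pair (i := Some i) (j := None) indX).
(* Outside all the [N i], the vector [X w] itself is a separating functional. *)
have SN : ~` S `<=` \bigcup_(i in [set` index_enum 'I_n]) N i.
  move=> w; apply: contra_notP => wN; exists (X w) => _ [i _ <-].
  rewrite ltNge; apply/negP => wi; apply: wN; exists i => //=.
  exact: mem_index_enum.
have PSC : (P (~` S) <= (\sum_(i < n) fine (P (N i)))%:E)%E.
  have := content_sub_fsum P (finite_seq _) (fun i _ => mN i)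
    (measurableC mS) SN.
  move=> /le_trans; apply; rewrite -fsbig_seq ?index_enum_uniq// -sumEFin.
  by apply: lee_sum => i _; rewrite fineK// fin_num_measure.
have sumN : \sum_(i < n) fine (P (N i)) < n%:R / 2 ^+ d.
  rewrite -[n in n%:R]card_ord mulr_natl -sumr_const.
  (* Summation keeps the inequality strict only over a nonempty index set, whence the witness built
     from [0 < n]. *)
  by apply: ltr_sum => //; apply/hasP; exists (Ordinal n0); rewrite // mem_index_enum.
have PSfin : P S \is a fin_num by exact: fin_num_measure.
move: PSC; rewrite probability_setC// -(fineK PSfin) -EFinB lee_fin lte_fin.
by move: sumN; lra.
Qed.
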